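(* For every $\omega\in\Omega$ and every $n\ge 0$, $$\big(\mathcal H(n),\ \mathbb H(n)\big)=\left(\widetilde T^{-1}(n),\ \sum_{k=1}^{\widetilde T^{-1}(n)}\mathbb Y(k)\right)\circ\vartheta^n .$$
   Context: Measures. $\mathcal M$ is the set of finite point measures on $(0,\infty)$, $\epsilon_x$ is the Dirac mass at $x$, $\mathbf z$ is the zero measure. For $\nu\in\mathcal M$, $|\nu|=\nu(0,\infty)$ is its mass and $\pi(\nu)$ is the supremum of its support ($\pi(\mathbf z)=0$). $\Upsilon_k(\nu)$ is obtained from $\nu$ by removing its $k$ largest atoms, counted with multiplicity ($\Upsilon_k(\nu)=\mathbf z$ if $k\ge|\nu|$). $\mathcal M^*=\bigcup_{n\ge 0}(\mathcal M\setminus\{\mathbf z\})^n$ is the set of finite sequences of non-zero measures; the empty sequence is identified with $\mathbf z$, a non-zero measure with a sequence of length one; $[Y_1,\dots,Y_N]$ denotes concatenation ($\mathbf z$ being neutral). For $Y\in\mathcal M^*$ of length $\mathrm{Len}(Y)$, $\pi(Y)=\sum_{k=1}^{\mathrm{Len}(Y)}\pi(Y(k))$. Conventions: $\max\emptyset=\sup\emptyset=-\infty$, $\min\emptyset=\inf\emptyset=+\infty$, empty sums are $0$. Sticks and operators. $\mathbb L=\{(v,\nu)\in(0,\infty)\times\mathcal M: v\ge\pi(\nu)\}$ and $\Omega=\mathbb L^{\mathbb Z}$; $\omega=(\omega_n,n\in\mathbb Z)$ with $\omega_n=(V_n,\mathcal P_n)$. All quantities below are functions of $\omega$. $\theta_n(\omega)=(\omega_{n+k},k\in\mathbb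 Z)$ (shift), $\vartheta^n(\omega)=(\omega_{n-k-1},k\in\mathbb Z)$ (dual operator), $\mathcal G(\omega)=((1,|\mathcal P_n|\epsilon_1),n\in\mathbb Z)$ (genealogical operator). In $X\circ\vartheta^n$ (or $X\circ\theta_n$), everything in $X$, including random indices, is evaluated at $\vartheta^n(\omega)$ (resp. $\theta_n(\omega)$). Spine and heights. For $Y\in\mathcal M^*$, $\nu\in\mathcal M$, put $H=\max\{k\ge1:|Y(k)|\ge2\}$ and $\Phi(Y,\nu)=[Y,\nu]$ if $\nu\ne\mathbf z$; $\Phi(Y,\nu)=(Y(1),\dots,Y(H-1),\Upsilon_1(Y(H)))$ if $\nu=\mathbf z$ and $H\ge1$; $\Phi(Y,\nu)=\mathbf z$ otherwise. The spine process is $\mathbb S^0_0=\mathbf z$, $\mathbb S^{n+1}_0=\Phi(\mathbb S^n_0,\mathcal P_n)$, $n\ge0$. The chronological height process is $\mathbb H(n)=\pi(\mathbb S^n_0)$, the genealogical height process is $\mathcal H=\mathbb H\circ\mathcal G$. Lukasiewicz path. $S(0)=0$ and, for $n\ge1$, $S(n)=\sum_{k=0}^{n-1}(|\mathcal P_k|-1)$, $S(-n)=-\sum_{k=-n}^{-1}(|\mathcal P_k|-1)$. Weak ascending ladder times: $T(0)=0$, $T(k+1)=\inf\{\ell>T(k):S(\ell)\ge S(T(k))\}$ (with $T(k+1)=\infty$ if $T(k)=\infty$). $\tau_\ell=\inf\{k>0:S(k)\ge\ell\}$; if $\tau_\ell<\infty$, $\zeta_\ell=\ell-S(\tau_\ell-1)$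 and $\mu_\ell=\Upsilon_{\zeta_\ell}(\mathcal P_{\tau_\ell-1})$. For $k\ge1$ with $T(k)<\infty$, $\mathcal Q(k)=\mu_0\circ\theta_{T(k-1)}$ and $\mathbb Y(k)=\pi(\mathcal Q(k))$. Finally $\widetilde T^{-1}(n)=\max\{k\ge0:T(k)\le n\}$. *)

(* Defs.v *)
From HB Require Import structures.
From mathcomp Require Import all_boot all_order all_algebra.
From mathcomp Require Import finmap multiset interval_inference.
From mathcomp Require Import boolp classical_sets reals ereal measure.
From mathcomp Require Import lebesgue_stieltjes_measure.
Set Implicit Arguments.
Unset Strict Implicit.
Unset Printing Implicit Defensive.
Import Order.TTheory GRing.Theory Num.Theory.
Local Open Scope classical_set_scope.
Local Open Scope ring_scope.

(** ** Extrema of sets of natural numbers *)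

(* Minimum of P in N with an added point at infinity: None stands for the
   infinity, which is the infimum of the empty set. *)
Definition nat_inf (P : pred nat) : option nat :=
  if pselect (exists n, P n) is left exP then Some (ex_minn exP) else None.

(* Greatest element of P. The default value 0 is only reached when there is no
   such element. *)
Definition nat_max (P : set nat) : nat :=
  xget 0%N [set m | P m /\ forall k, P k -> (k <= m)%N].

Lemma nat_inf_Some (P : pred nat) m :
  nat_inf P = Some m <-> P m /\ forall k, P k -> (m <= k)%N.
Proof.
rewrite /nat_inf; case: pselect => [exP|nexP]; last first.
  by split=> [//|[Pm _]]; case: nexP; exists m.
case: ex_minnP => p Pp pmin; split=> [[<-]//|[Pm mmin]].
by congr Some; apply/eqP; rewrite eqn_leq pmin // mmin.
Qed.

Lemma nat_maxP (P : set nat) m b :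
  P m -> (forall k, P k -> (k <= b)%N) ->
  P (nat_max P) /\ forall k, P k -> (k <= nat_max P)%N.
Proof.
move=> Pm Pb; rewrite /nat_max; case: xgetP => [? -> //|noP]; exfalso.
have exP : exists n, `[< P n >] by exists m; apply/asboolP.
have ubP n : `[< P n >] -> (n <= b)%N by move=> /asboolP /Pb.
case: (ex_maxnP exP ubP) => i /asboolP Pi imax.
by apply: (noP i); split=> // k Pk; apply/imax/asboolP.
Qed.

(** ** Finite point measures *)

(* A finite point measure on (0, oo) is represented by the finite multiset of
   its atoms, counted with multiplicity; point_measure is the measure itself,
   and point_measure_inj states that nothing is lost. *)
Notation pmeas R := {mset {posnum R}}%mset.

Section PointMeasure.
Context {R : realType}.
Implicit Types (nu : pmeas R) (x : {posnum R}).

Definition zmeas : pmeas R := mset0.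

Definition point_measure nu (A : set (measurableTypeR R)) : \bar R :=
  (\sum_(x <- nu) \d_(x%:num : measurableTypeR R) A)%E.

Definition mass nu : nat := size nu.

(* By convention the supremum of the empty set is 0 here (lemma sup0). *)
Definition pi_meas nu : R := sup [set x%:num | x in [set y | y \in nu]].

Definition Upsilon (k : nat) nu : pmeas R :=
  seq_mset (drop k (sort (fun x y => y%:num <= x%:num) nu)).

Lemma point_measure_mass nu :
  point_measure nu [set t | 0 < t] = ((mass nu)%:R)%:E.
Proof.
rewrite /point_measure /mass -sum1_size natr_sum -sumEFin.
apply: eq_bigr => x _; rewrite diracE.
by rewrite mem_set /=.
Qed.

Lemma point_measure_inj : injective point_measure.
Proof.
have E nu x : point_measure nu [set x%:num] = ((nu x)%:R)%:E.
  rewrite /point_measure -count_mem_mset -sum1_count natr_sum -sumEFin.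
  rewrite [RHS]big_mkcond; apply: eq_bigr => y _; rewrite diracE /=.
  case: eqP => [->|neq_yx]; first by rewrite mem_set.
  by rewrite memNset //= => eq_yx; apply/neq_yx/val_inj.
move=> mu nu eq_munu; apply/fsfunP => x; apply/eqP.
by rewrite -(eqr_nat R) -eqe -!E eq_munu.
Qed.

End PointMeasure.

(** ** Finite sequences of non-zero measures *)

Definition mseq (R : realType) := seq {nu : pmeas R | nu != zmeas}.

Section MeasureSequence.
Context {R : realType}.
Implicit Types (Y : mseq R) (nu : pmeas R).

(* The identification of measures with sequences of length at most one: a
   non-zero measure gives a one-term sequence, the zero measure the empty one. *)
Definition mseq_of nu : mseq R := pmap insub [:: nu].

(* Y(k), for 1 <= k <= Len(Y) *)
Definition mnth Y (k : nat) : pmeas R := nth zmeas (map val Y) k.-1.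

Definition pi_seq Y : R := \sum_(1 <= k < (size Y).+1) pi_meas (mnth Y k).

(* The index H of the last measure with at least two atoms; it is 0 instead of
   -oo when there is none, and only the test H >= 1 is ever made on it. *)
Definition last_branching Y : nat :=
  \max_(1 <= k < (size Y).+1 | (2 <= mass (mnth Y k))%N) k.

Definition Phi Y nu : mseq R :=
  let H := last_branching Y in
  if nu != zmeas then Y ++ mseq_of nu
  else if (1 <= H)%N then take H.-1 Y ++ mseq_of (Upsilon 1 (mnth Y H))
  else [::].

End MeasureSequence.

(** ** Sticks and operators *)

Definition stick (R : realType) :=
  {p : {posnum R} * pmeas R | pi_meas p.2 <= p.1%:num}.

Definition Omega (R : realType) := int -> stick R.

Section Operators.
Context {R : realType}.
Implicit Types (w : Omega R) (n k : int).

Definition V_ w n : {posnum R} := (val (w n)).1.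
Definition P_ w n : pmeas R := (val (w n)).2.

Definition shift n w : Omega R := fun k => w (n + k).

Definition dual n w : Omega R := fun k => w (n - k - 1).

Definition one_pos : {posnum R} := PosNum ltr01.

Lemma pi_msetn_one (m : nat) : pi_meas (msetn m one_pos) <= one_pos%:num.
Proof.
rewrite /pi_meas; set A := (X in sup X).
have ubA : ubound A one_pos%:num.
  by move=> _ [x /= xm <-]; move: xm; rewrite in_msetn => /andP[_ /eqP ->].
have [->|/set0P A0] := eqVneq A set0; first by rewrite sup0.
exact: ge_sup.
Qed.

Definition genealogical w : Omega R := fun n =>
  exist (fun p : {posnum R} * pmeas R => pi_meas p.2 <= p.1%:num)
    (one_pos, msetn (mass (P_ w n)) one_pos) (pi_msetn_one _).

End Operators.

(** ** Spine and height processes *)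

Section Heights.
Context {R : realType}.
Implicit Types w : Omega R.

Fixpoint spine w (n : nat) : mseq R :=
  if n is m.+1 then Phi (spine w m) (P_ w m%:Z) else [::].

Definition chron_height w (n : nat) : R := pi_seq (spine w n).

Definition gen_height w (n : nat) : R := chron_height (genealogical w) n.

End Heights.

(** ** Lukasiewicz path and ladder times *)

Section Lukasiewicz.
Context {R : realType}.
Implicit Types w : Omega R.

Definition Luka w (n : int) : int :=
  match n with
  | Posz m => \sum_(0 <= k < m) ((mass (P_ w k%:Z))%:Z - 1)
  (* Negz m is -(m+1); the index k is the opposite of the usual one *)
  | Negz m => - \sum_(1 <= k < m.+2) ((mass (P_ w (- k%:Z)))%:Z - 1)
  end.

Fixpoint ladder w (k : nat) : option nat :=
  if k is j.+1 then
    if ladder w j is Some t then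
      nat_inf (fun l : nat => (t < l)%N && (Luka w t%:Z <= Luka w l%:Z))
    else None
  else Some 0%N.

Definition tau w (l : nat) : option nat :=
  nat_inf (fun k : nat => (0 < k)%N && (l%:Z <= Luka w k%:Z)).

(* Arbitrary when tau_l is infinite. *)
Definition zeta w (l : nat) : int :=
  if tau w l is Some t then l%:Z - Luka w (t%:Z - 1) else 0.

Lemma zeta_ge0 w l : 0 <= zeta w l.
Proof.
rewrite /zeta; case E : (tau w l) => [[|t]|//].
  by move/nat_inf_Some: E => [].
have -> : t.+1%:Z - 1 = t%:Z by rewrite intS addrC addKr.
rewrite subr_ge0 leNgt; apply/negP => lt_l.
have [_ tmin] := (nat_inf_Some _ _).1 E.
case: t E lt_l tmin => [_|t _ lt_l tmin]; first by rewrite /= big_nil.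
by have := tmin t.+1; rewrite /= (ltW lt_l) ltnn => /(_ isT).
Qed.

(* Arbitrary when tau_l is infinite; the absolute value is only a cast from
   int to nat, by zeta_ge0. *)
Definition mu_ w (l : nat) : pmeas R :=
  if tau w l is Some t then Upsilon `|zeta w l|%N (P_ w (t%:Z - 1)) else zmeas.

(* Meaningful for k >= 1 and T(k) finite. *)
Definition Q_ w (k : nat) : pmeas R :=
  if ladder w k.-1 is Some t then mu_ (shift t%:Z w) 0 else zmeas.

Definition Y_ w (k : nat) : R := pi_meas (Q_ w k).

Definition ladder_le w (n : nat) : set nat :=
  [set k | if ladder w k is Some t then (t <= n)%N else false].

Definition ladder_inv w (n : nat) : nat := nat_max (ladder_le w n).

Lemma ladder_ge w k t : ladder w k = Some t -> (k <= t)%N.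
Proof.
elim: k t => [//|k IH] t /=; case: (ladder w k) IH => [s|//] IH.
by move=> /nat_inf_Some[/andP[lt_st _] _]; apply: leq_ltn_trans lt_st; apply: IH.
Qed.

(* The maximum defining ladder_inv is attained. *)
Lemma ladder_invP w n : ladder_le w n (ladder_inv w n) /\
  forall k, ladder_le w n k -> (k <= ladder_inv w n)%N.
Proof.
apply: (@nat_maxP _ 0 n) => //= k; rewrite /ladder_le /=.
by case E : (ladder w k) => [t|//] tn; apply: leq_trans (ladder_ge E) tn.
Qed.

End Lukasiewicz.

(* Main.v *)
Require Import Defs.
From mathcomp Require Import all_boot all_order all_algebra.
From mathcomp Require Import finmap multiset interval_inference.
From mathcomp Require Import boolp classical_sets reals.
From mathcomp Require Import zify.
Import Order.TTheory GRing.Theory Num.Theory.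
Local Open Scope ring_scope.

(** Read from its last entry to its first, the spine at time n is exactly the
list Q(1), Q(2), ..., Q(K), K = T~^{-1}(n), computed on the dual sequence
(rev_spine). Since pi of a sequence is a sum over its entries, this gives the
chronological height at once. The genealogical sequence has the same ladder
times, and all its atoms sit at 1: as no entry of the spine is zero, each of
them contributes 1, and the genealogical height is the number K of entries.

The identity of lists is proved by induction on n. Going from n to n+1 adds
P_n to the spine and puts it in front of the dual sequence. If P_n is not
zero, the path of the dual sequence is at least 0 after one step, which is
therefore a ladder time, and P_n becomes the new Q(1). If P_n is zero, the path
steps down to -1, so the next weak ladder time is the first passage of the
shifted path at level 1. That passage happens at the ladder time T(j), where j
is the least index such that S(T(j)) - S(T(j-1)) = |Q(j)| - 1 is positive; there
the measure is recorded with one more atom removed, while the single-atom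
measures Q(1), ..., Q(j-1) disappear; if there is no such j up to time n, both
the list and the spine become empty. This is what Phi does to the spine
(passage_measures_prune, rev_Phi).

The two ways of restarting the path that are used here are the renewal of
ladder times at T(1) (ladder_renewal, ladder_measuresE) and the change of level
when the path is restarted at an earlier time (passage_measures_shift). *)

(** * First passages and ladder times *)

Lemma nat_inf_None (P : pred nat) : nat_inf P = None <-> forall k, ~~ P k.
Proof.
rewrite /nat_inf; case: pselect => [exP|nexP]; split=> //.
  by case: exP => k Pk /(_ k); rewrite Pk.
by move=> _ k; apply/negP => Pk; apply: nexP; exists k.
Qed.

Lemma eq_nat_inf (P Q : pred nat) : P =1 Q -> nat_inf P = nat_inf Q.
Proof. by move=> /funext ->. Qed.

Lemma nat_inf_shift (P : pred nat) (t : nat) :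
  (forall k, P k -> (t <= k)%N) ->
  nat_inf P = omap (addn t) (nat_inf (fun k => P (t + k)%N)).
Proof.
move=> Pt; case E: (nat_inf (fun k => P (t + k)%N)) => [m|].
  have [Pm mmin] := (nat_inf_Some _ _).1 E.
  apply/nat_inf_Some; split=> // k Pk.
  by rewrite -leq_subRL ?Pt //; apply: mmin; rewrite subnKC ?Pt.
have noP := (nat_inf_None _).1 E; apply/nat_inf_None => k; apply/negP => Pk.
by have := noP (k - t)%N; rewrite subnKC ?Pt // Pk.
Qed.

#[local] Arguments Luka : simpl never.

Section Path.
Context {R : realType}.
Implicit Types (w : Omega R) (t s n l : nat).

Lemma Luka0 w : Luka w 0%N%:Z = 0.
Proof. by rewrite /Luka /= big_nil. Qed.

Lemma LukaD w t s :
  Luka w (t + s)%N%:Z = Luka w t%:Z + Luka (shift t%:Z w) s%:Z.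
Proof.
rewrite /Luka (big_cat_nat (n := t)) ?leq_addr //=; congr (_ + _).
rewrite -{1}[t]add0n big_addn addKn; apply: eq_bigr => k _.
by rewrite addnC PoszD.
Qed.

Lemma Luka1 w : Luka w 1%N%:Z = (mass (P_ w 0%N%:Z))%:Z - 1.
Proof. by rewrite /Luka /= big_nat1. Qed.

Lemma LukaS w t : Luka w t.+1%:Z = Luka w t%:Z + (mass (P_ w t%:Z))%:Z - 1.
Proof. by rewrite /Luka /= big_nat_recr //= addrA. Qed.

Lemma shiftD w t s : shift (t + s)%N%:Z w = shift s%:Z (shift t%:Z w).
Proof. by apply/funext => k; rewrite /shift PoszD addrA. Qed.

Lemma shift0 w : shift 0 w = w.
Proof. by apply/funext => k; rewrite /shift add0r. Qed.

Lemma ladder1 w : ladder w 1 = tau w 0.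
Proof. by apply: eq_nat_inf => l; rewrite Luka0. Qed.

(** The path restarted at its first weak ladder time t has ladder times
T(k+1) - t, because only increments of the path are compared. *)
Lemma ladder_renewal w t k : tau w 0 = Some t ->
  ladder w k.+1 = omap (addn t) (ladder (shift t%:Z w) k).
Proof.
move=> tau_t; elim: k => [|k IH]; first by rewrite ladder1 tau_t /= addn0.
rewrite [LHS]/= -/(ladder w k.+1) IH /=.
case: (ladder _ k) => [s|] //=.
rewrite (nat_inf_shift _ t); last first.
  by move=> l /andP[/ltnW/(leq_trans (leq_addr _ _))].
by congr omap; apply: eq_nat_inf => l; rewrite ltn_add2l !LukaD lerD2l.
Qed.

Lemma ladder_None w k : tau w 0 = None -> ladder w k.+1 = None.
Proof.
move=> tau_None; elim: k => [|k IH]; first by rewrite ladder1.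
by rewrite [LHS]/= -/(ladder w k.+1) IH.
Qed.

Lemma ladder_inv_unique w n m : ladder_le w n m ->
  (forall k, ladder_le w n k -> (k <= m)%N) -> ladder_inv w n = m.
Proof.
move=> lem max_m; have [le_inv max_inv] := ladder_invP w n.
by apply/eqP; rewrite eqn_leq max_m // max_inv.
Qed.

Lemma ladder_inv_renewal w n t : tau w 0 = Some t -> (t <= n)%N ->
  ladder_inv w n = (ladder_inv (shift t%:Z w) (n - t)).+1.
Proof.
move=> tau_t le_tn.
have leE k : ladder_le w n k.+1 = ladder_le (shift t%:Z w) (n - t) k.
  rewrite /ladder_le /= -/(ladder w k.+1) (ladder_renewal _ _ _ tau_t).
  by case: (ladder _ k) => [s|] //=; rewrite leq_subRL.
have [le_inv max_inv] := ladder_invP (shift t%:Z w) (n - t).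
apply: ladder_inv_unique; first by rewrite leE.
by case=> [//|k]; rewrite leE; apply: max_inv.
Qed.

Lemma ladder_inv_eq0 w n :
  (forall t, tau w 0 = Some t -> (n < t)%N) -> ladder_inv w n = 0%N.
Proof.
move=> late; apply: ladder_inv_unique => // -[//|k].
rewrite /ladder_le /= -/(ladder w k.+1).
case E: (tau w 0) => [t|]; last by rewrite ladder_None.
rewrite (ladder_renewal _ _ _ E); case: (ladder _ k) => [s|] //= le_n.
by have := leq_trans (late _ E) (leq_trans (leq_addr s t) le_n); rewrite ltnn.
Qed.

End Path.

(** * Measures recorded at first passages *)

Section Measures.
Context {R : realType}.
Implicit Types (w : Omega R) (nu : pmeas R) (d t n : nat).

Definition decr_posnum : rel {posnum R} := fun x y => y%:num <= x%:num.

Lemma perm_Upsilon k nu :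
  perm_eq (Upsilon k nu) (drop k (sort decr_posnum nu)).
Proof. exact: perm_eq_seq_mset. Qed.

Lemma mass_Upsilon k nu : mass (Upsilon k nu) = (mass nu - k)%N.
Proof.
by rewrite /mass (perm_size (perm_Upsilon k nu)) size_drop size_sort.
Qed.

Lemma Upsilon_sub k nu x : x \in Upsilon k nu -> x \in nu.
Proof.
have -> : (x \in Upsilon k nu) = (x \in (Upsilon k nu : seq _)) by [].
rewrite (perm_mem (perm_Upsilon k nu)) => /mem_drop.
by rewrite mem_sort.
Qed.

(** The representation of measures forgets the order of the atoms, so that the
inner truncation has to be seen to survive the second sorting. *)
Lemma Upsilon_Upsilon j k nu : Upsilon j (Upsilon k nu) = Upsilon (j + k) nu.
Proof.
have leT : total decr_posnum by move=> x y; apply: le_total.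
have leTr : transitive decr_posnum by move=> y x z xy yz; apply: le_trans yz xy.
have leA : antisymmetric decr_posnum.
  by move=> x y; rewrite /decr_posnum -eq_le => /eqP /val_inj.
rewrite /Upsilon -drop_drop -/decr_posnum; congr (seq_mset (drop j _)).
rewrite (perm_sortP leT leTr leA _ _ (perm_eq_seq_mset _)).
by rewrite sorted_sort // drop_sorted // sort_sorted.
Qed.

Lemma mass_eq0 nu : (mass nu == 0%N) = (nu == zmeas).
Proof. exact: size_mset_eq0. Qed.

Lemma mass_gt0 nu : (0 < mass nu)%N = (nu != zmeas).
Proof. by rewrite lt0n mass_eq0. Qed.

Lemma tau_Some w d t : tau w d = Some t <->
  [/\ (0 < t)%N, d%:Z <= Luka w t%:Z &
      forall k, (0 < k < t)%N -> Luka w k%:Z < d%:Z].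
Proof.
split=> [/nat_inf_Some[/andP[t0 dt] tmin]|[t0 dt tmin]].
  split=> // k /andP[k0 kt]; rewrite ltNge; apply/negP => dk.
  by have := tmin k; rewrite k0 dk leqNgt kt => /(_ isT).
apply/nat_inf_Some; split; first by rewrite t0.
move=> k /andP[k0 dk]; rewrite leqNgt; apply/negP => kt.
by have := tmin k; rewrite k0 kt => /(_ isT); rewrite ltNge dk.
Qed.

Lemma mu_E w d t : tau w d = Some t.+1 ->
  mu_ w d = Upsilon `|d%:Z - Luka w t%:Z|%N (P_ w t%:Z).
Proof.
move=> tauE; have zetaE : t.+1%:Z - 1 = t%:Z by lia.
by rewrite /mu_ /zeta tauE zetaE.
Qed.

Definition ladder_measures w n : seq (pmeas R) :=
  [seq Q_ w k | k <- iota 1 (ladder_inv w n)].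

(** The first-passage analogue of ladder_measures: the measure recorded when
the path first reaches level d, followed by the ladder measures from that time
on. Level 0 is the ladder list itself (ladder_measuresE); level 1 is needed
because a zero measure in front of the sequence lowers the path by one. *)
Definition passage_measures w d n : seq (pmeas R) :=
  if tau w d is Some t then
    if (t <= n)%N then mu_ w d :: ladder_measures (shift t%:Z w) (n - t)
    else [::]
  else [::].

(** T(1) is the first passage at level 0, and everything after it is the ladder
structure of the restarted path. *)
Lemma ladder_measuresE w n : ladder_measures w n = passage_measures w 0 n.
Proof.
rewrite /passage_measures; case E: (tau w 0) => [t|]; last first.
  by rewrite /ladder_measures ladder_inv_eq0 // E.
case: leqP => [tn|nt]; last first.
  by rewrite /ladder_measures ladder_inv_eq0 // E => _ [<-].
rewrite /ladder_measures (ladder_inv_renewal _ _ _ E tn).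
rewrite /= /Q_ /= shift0; congr (_ :: _).
rewrite (iotaDl 1 1) -map_comp; apply/eq_in_map => -[|k].
  by rewrite mem_iota.
move=> _; rewrite -[LHS]/(Q_ w k.+2) /Q_ [k.+2.-1]/= [k.+1.-1]/=.
rewrite (ladder_renewal _ _ _ E).
by case: (ladder _ k) => [s|] //=; rewrite shiftD.
Qed.

(** A path that stays below level d up to time t, where it is at d - 1, reaches
d exactly when the path restarted at t reaches 1. The overshoot, hence the
measure that is recorded, is the same for both. *)
Lemma passage_measures_shift w d t n :
  d%:Z = Luka w t%:Z + 1 -> (t <= n)%N ->
  (forall k, (0 < k <= t)%N -> Luka w k%:Z < d%:Z) ->
  passage_measures w d n = passage_measures (shift t%:Z w) 1 (n - t).
Proof.
move=> dE tn below.
have tauE : tau w d = omap (addn t) (tau (shift t%:Z w) 1).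
  rewrite /tau (nat_inf_shift _ t); last first.
    move=> k /andP[k0 dk]; rewrite leqNgt; apply/negP => kt.
    by have := below k; rewrite k0 ltnW // ltNge dk => /(_ isT).
  congr omap; apply: eq_nat_inf => -[|k].
    rewrite addn0 ltnn; apply/negbTE/negP => /andP[_ dk].
    by move: dk; rewrite dE; lia.
  by rewrite addnS /= -addnS LukaD dE lerD2l.
rewrite /passage_measures tauE.
case E: (tau (shift t%:Z w) 1) => [[|s]|] //=.
  by case/tau_Some: E.
rewrite leq_subRL // -shiftD subnDA.
case: ifP => // _; congr (_ :: _).
rewrite (mu_E _ _ _ E) (mu_E _ _ (t + s)); last by rewrite tauE E /= addnS.
rewrite LukaD dE; congr Upsilon.
  by congr absz; lia.
Qed.

(** What Phi does to the reversed spine when it is fed the zero measure. *)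
Fixpoint prune (s : seq (pmeas R)) : seq (pmeas R) :=
  if s is nu :: s' then
    if (2 <= mass nu)%N then Upsilon 1 nu :: s' else prune s'
  else [::].

(** If the first passage at level 0 already reaches level 1, it is also the
first passage at level 1, with one more atom removed. Otherwise the path is back
at 0 with a single-atom measure, and one restarts from there. *)
Lemma passage_measures_prune w n :
  passage_measures w 1 n = prune (passage_measures w 0 n).
Proof.
elim/ltn_ind: n w => n IH w.
case E: (tau w 0) => [t|]; last first.
  rewrite {2}/passage_measures E /passage_measures.
  case E1: (tau w 1) => [s|] //.
  have noP := (nat_inf_None _).1 E.
  have [s0 s1 _] := (tau_Some _ _ _).1 E1.
  by have := noP s; rewrite s0 (le_trans _ s1).
have [t0 Lt_ge0 below] := (tau_Some _ _ _).1 E.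
rewrite {2}/passage_measures E; case: leqP => [tn|nt]; last first.
  rewrite /passage_measures; case E1: (tau w 1) => [s|] //.
  case: leqP => // sn; have [s0 s1 _] := (tau_Some _ _ _).1 E1.
  by have := below s; rewrite s0 (leq_ltn_trans sn nt) => /(_ isT); lia.
case: t E t0 Lt_ge0 below tn => // t E _ Lt_ge0 below tn.
(* Before its first return to level 0 the path is negative, and it starts at 0;
   hence zeta is minus its last value. *)
have Lt_le0 : Luka w t%:Z <= 0.
  by case: t {E Lt_ge0 tn} below => [_|t /(_ t.+1)];
    rewrite ?Luka0 // !ltnS leqnn => /(_ isT)/ltW.
rewrite /= (mu_E _ _ _ E) mass_Upsilon.
have LtS := LukaS w t.
have absL : `|0%:Z - Luka w t%:Z|%N%:Z = - Luka w t%:Z.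
  by rewrite sub0r abszN lez0_abs.
case: ltnP => [mass2|mass1].
  have E1 : tau w 1 = Some t.+1.
    apply/tau_Some; split=> //; first lia.
    by move=> k /below; lia.
  rewrite /passage_measures E1 tn (mu_E _ _ _ E1) Upsilon_Upsilon.
  by congr (Upsilon _ _ :: _); lia.
(* Here |Q(1)| <= 1, that is, the path is exactly at 0 at time t+1. *)
rewrite (passage_measures_shift w 1 t.+1) //; first last.
- move=> k /andP[k0]; rewrite leq_eqVlt => /orP[/eqP ->|kt]; first lia.
  by have := below k; rewrite k0 kt => /(_ isT); lia.
- lia.
by rewrite IH ?ladder_measuresE //; lia.
Qed.

Definition spine_step (s : seq (pmeas R)) nu :=
  if nu != zmeas then nu :: s else prune s.

(** The lists attached to the dual sequences obey the recursion of the spine: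
going back one step in time adds one measure in front. *)
Lemma ladder_measures_step w n :
  ladder_measures w n.+1 =
  spine_step (ladder_measures (shift 1%N%:Z w) n) (P_ w 0%N%:Z).
Proof.
rewrite /spine_step [LHS]ladder_measuresE -mass_gt0; have L1 := Luka1 w.
case: ifP => mass0.
  have E : tau w 0 = Some 1%N.
    by apply/tau_Some; split=> //; [lia | case=> [|k]; rewrite ?andbF].
  rewrite /passage_measures E /= subn1 (mu_E _ _ _ E) Luka0 subr0.
  congr (_ :: _); rewrite /Upsilon /= drop0.
  by apply/eqP; rewrite -[X in _ == X]seq_mset_id; apply/eqP/eq_seq_msetP;
    rewrite perm_sort.
rewrite (passage_measures_shift w 0 1) //; first last.
- by case=> [|[|k]] // _; lia.
- lia.
by rewrite subn1 passage_measures_prune -ladder_measuresE.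
Qed.

Lemma ladder_measures0 w : ladder_measures w 0 = [::].
Proof.
rewrite ladder_measuresE /passage_measures.
by case E: (tau w 0) => [[|t]|] //; case/tau_Some: E.
Qed.

End Measures.

(** * The spine as a stack of measures *)

Section Spine.
Context {R : realType}.
Implicit Types (w : Omega R) (Y : mseq R) (nu : pmeas R) (n : nat).

Lemma mseq_ofK nu : nu != zmeas -> map val (mseq_of nu) = [:: nu].
Proof. by move=> nu0; rewrite /mseq_of /= insubT. Qed.

Lemma last_branching_size Y : (last_branching Y <= size Y)%N.
Proof.
by apply/bigmax_leqP_seq => k; rewrite mem_index_iota ltnS => /andP[].
Qed.

Lemma mnth_rcons Y y k : (k <= size Y)%N -> (0 < k)%N ->
  mnth (rcons Y y) k = mnth Y k.
Proof.
by case: k => // k kY _; rewrite /mnth map_rcons nth_rcons size_map kY.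
Qed.

Lemma mnth_last Y y : mnth (rcons Y y) (size Y).+1 = val y.
Proof. by rewrite /mnth map_rcons nth_rcons size_map ltnn eqxx. Qed.

Lemma last_branching_rcons Y y : last_branching (rcons Y y) =
  if (2 <= mass (val y))%N then (size Y).+1 else last_branching Y.
Proof.
have := last_branching_size Y.
rewrite /last_branching size_rcons => le_size.
rewrite big_mkcond big_nat_recr //= mnth_last.
under eq_big_nat => k /andP[k0 kY] do rewrite mnth_rcons //.
rewrite -big_mkcond; case: ifP => _; last exact: maxn0.
by apply/maxn_idPr/leqW.
Qed.

(** The last branching measure of the spine is the first one met by prune in the
reversed list. *)
Lemma rev_Phi Y nu :
  rev (map val (Phi Y nu)) = spine_step (rev (map val Y)) nu.
Proof.
rewrite /Phi /spine_step; case: ifP => [nu0|_].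
  by rewrite map_cat mseq_ofK // rev_cat.
elim/last_ind: Y => [|Y y IH].
  by rewrite /last_branching big_geq.
rewrite last_branching_rcons map_rcons rev_rcons /=.
have [mass2|_] := boolP (2 <= mass (val y))%N.
  rewrite mnth_last -cats1 take_size_cat // map_cat mseq_ofK ?rev_cat //.
  by rewrite -mass_gt0 mass_Upsilon subn_gt0.
rewrite -IH; have leY := last_branching_size Y.
case: ifP => // H0; rewrite mnth_rcons // -cats1 takel_cat //.
exact: leq_trans (leq_pred _) leY.
Qed.

(** The pathwise identity behind both heights; it holds for the measures
themselves and not only for their suprema. *)
Lemma rev_spine w n :
  rev (map val (spine w n)) = ladder_measures (dual n%:Z w) n.
Proof.
elim: n => [|n IH]; first by rewrite ladder_measures0.
rewrite [spine _ _]/= rev_Phi IH ladder_measures_step.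
congr (spine_step (ladder_measures _ n) _).
  by apply/funext => k; rewrite /shift /dual; congr w; lia.
by rewrite /P_ /dual; congr (val (w _)).2; lia.
Qed.

Lemma pi_seqE Y : pi_seq Y = \sum_(nu <- rev (map val Y)) pi_meas nu.
Proof.
rewrite (perm_big (map val Y)) ?perm_rev //=.
by rewrite /pi_seq big_add1 /= (big_nth zmeas) size_map.
Qed.

Lemma chron_heightE w n : chron_height w n =
  \sum_(1 <= k < (ladder_inv (dual n%:Z w) n).+1) Y_ (dual n%:Z w) k.
Proof.
by rewrite /chron_height pi_seqE rev_spine big_map /index_iota subn1.
Qed.

Lemma ladder_genealogical w k : ladder (genealogical w) k = ladder w k.
Proof.
have massE j : mass (P_ (genealogical w) j) = mass (P_ w j).
  by rewrite /mass /P_ /= enum_msetn size_nseq.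
have LukaE l : Luka (genealogical w) l = Luka w l.
  by case: l => m; rewrite /Luka; [|congr (- _)];
    apply: eq_bigr => i _; rewrite massE.
elim: k => //= k ->; case: (ladder w k) => // t.
by apply: eq_nat_inf => l; rewrite !LukaE.
Qed.

Lemma ladder_inv_genealogical w n :
  ladder_inv (genealogical w) n = ladder_inv w n.
Proof.
by rewrite /ladder_inv; congr nat_max; apply/funext => k;
  rewrite /ladder_le /= ladder_genealogical.
Qed.

Lemma Q_sub w k x : x \in Q_ w k -> exists j, x \in P_ w j.
Proof.
rewrite /Q_; case: ladder => [t|]; last by rewrite in_mset0.
rewrite /mu_; case: tau => [s|]; last by rewrite in_mset0.
by move=> /Upsilon_sub xP; exists (t%:Z + (s%:Z - 1)).
Qed.

Lemma pi_meas_one nu :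
  nu != zmeas -> (forall x, x \in nu -> x = one_pos) -> pi_meas nu = 1.
Proof.
rewrite -mass_gt0 => nu0 nu1; have [x xnu] : exists x, x \in nu.
  by case E: (nu : seq _) nu0 => [|x s]; rewrite /mass E // => _; exists x;
    rewrite -[_ \in _]/(x \in (nu : seq _)) E mem_head.
rewrite /pi_meas -[RHS](@sup1 R 1); congr sup; apply/seteqP; split=> y /=.
  by case=> z /nu1 -> <-.
by move=> ->; exists x => //; rewrite (nu1 _ xnu).
Qed.

(** The entries of the spine are non-zero by construction, and those of the
ladder list only have atoms of the sequence; for the genealogical sequence each
entry thus has supremum 1. *)
Lemma gen_heightE w n : gen_height w n = (ladder_inv (dual n%:Z w) n)%:R.
Proof.
rewrite /gen_height /chron_height pi_seqE.
rewrite (eq_big_seq (fun=> 1)); last first.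
  move=> nu nuS; apply: pi_meas_one.
    by move: nuS; rewrite mem_rev => /mapP[[z z0] _ ->].
  move: nuS; rewrite rev_spine => /mapP[k _ ->] x /Q_sub[j].
  by rewrite [P_ _ _]/= in_msetn => /andP[_ /eqP].
rewrite rev_spine big_const_seq count_predT size_map size_iota iter_addr_0.
by rewrite -[dual _ _]/(genealogical (dual n%:Z w)) ladder_inv_genealogical.
Qed.

End Spine.

Theorem proposition3p4 (R : realType) (w : Omega R) (n : nat) :
  (gen_height w n, chron_height w n) =
  let w' := dual n%:Z w in
  ((ladder_inv w' n)%:R, \sum_(1 <= k < (ladder_inv w' n).+1) Y_ w' k).
Proof. by rewrite gen_heightE chron_heightE. Qed.
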